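(* Let $\sigma>0$. Consider the problem $$\min_{\boldsymbol{x}\in\mathcal{X},\ \boldsymbol{y}\ge \boldsymbol{0}}\ \bigl\{ f(\boldsymbol{x})-\pi_{\mathcal{C}}(-\sigma\boldsymbol{y}) :\ g_s(\boldsymbol{x})\le y_s\ \ \forall s\in[S]\bigr\}$$ in the unconstrained form $\min_{(\boldsymbol{x},\boldsymbol{y})\in\mathbb{R}^d\times\mathbb{R}^S}\{\zeta(\boldsymbol{x},\boldsymbol{y})-\eta(\boldsymbol{x},\boldsymbol{y})\}$, where $$\zeta(\boldsymbol{x},\boldsymbol{y}):=f(\boldsymbol{x})+\delta_{\mathcal{X}}(\boldsymbol{x})+\delta_{\mathbb{R}^S_+}(\boldsymbol{y})+\delta_{\{(\boldsymbol{x},\boldsymbol{y}):\,g_s(\boldsymbol{x})\le y_s\ \forall s\in[S]\}}(\boldsymbol{x},\boldsymbol{y}),\qquad \eta(\boldsymbol{x},\boldsymbol{y}):=\pi_{\mathcal{C}}(-\sigma\boldsymbol{y}).$$ Let $(\boldsymbol{p},\boldsymbol{q})\in\mathbb{R}^d\times\mathbb{R}^S$ denote the dual variables associated with $(\boldsymbol{x},\boldsymbol{y})$. Then the Fenchel conjugates of $\eta$ and $\zeta$ satisfy: (i) $$\eta^*(\boldsymbol{p},\boldsymbol{q})=\delta_{\{\boldsymbol{0}\}}(\boldsymbol{p})+\inf_{\boldsymbol{z}\in\mathbb{R}^S}\bigl\{\delta_{\mathcal{C}}(\boldsymbol{z}):\ -\sigma\boldsymbol{z}=\boldsymbol{q}\bigr\};$$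 (ii) $$\zeta^*(\boldsymbol{p},\boldsymbol{q})=\sup_{\substack{\boldsymbol{x}\in\mathcal{X},\ \boldsymbol{y}\ge\boldsymbol{0}\\ g_s(\boldsymbol{x})\le y_s\ \forall s\in[S]}}\bigl\{\langle\boldsymbol{p},\boldsymbol{x}\rangle+\langle\boldsymbol{q},\boldsymbol{y}\rangle-f(\boldsymbol{x})\bigr\}.$$ Consequently, by parameterizing the dual variable of the support function directly by $\boldsymbol{z}\in\mathcal{C}$, the Toland dual $\min_{(\boldsymbol{p},\boldsymbol{q})}\{\eta^*(\boldsymbol{p},\boldsymbol{q})-\zeta^*(\boldsymbol{p},\boldsymbol{q})\}$ of this problem can be written as $$\min_{\boldsymbol{z}\in\mathcal{C}}\bigl(-\zeta^*(\boldsymbol{0},-\sigma\boldsymbol{z})\bigr)=\min_{\boldsymbol{z}\in\mathcal{C}}\ \inf_{\substack{\boldsymbol{x}\in\mathcal{X},\ \boldsymbol{y}\ge\boldsymbol{0}\\ g_s(\boldsymbol{x})\le y_s\ \forall s\in[S]}}\bigl\{f(\boldsymbol{x})+\sigma\,\boldsymbol{z}^\top\boldsymbol{y}\bigr\}.$$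
   Context: $[n]=\{1,\dots,n\}$. Let $S,I$ be positive integers, $\alpha\in(0,1)$, $m=\lfloor\alpha S\rfloor$. Standing assumptions: $\mathcal{X}\subseteq\mathbb{R}^d$ is compact, convex, with nonempty relative interior, contained in an open set $\mathcal{U}\subseteq\mathbb{R}^d$; $f:\mathcal{U}\to\mathbb{R}$ is continuously differentiable and convex; for each $s\in[S]$ (scenario $\xi^s$), $g_s(\boldsymbol{x})=\max_{i\in[I]}h_{s,i}(\boldsymbol{x})$ where each $h_{s,i}:\mathbb{R}^d\to\mathbb{R}$ is continuously differentiable and convex. $\mathcal{C}:=\{\boldsymbol{z}\in\mathbb{R}^S:\ 0\le z_s\le 1\ \forall s\in[S],\ \sum_{s=1}^S z_s\ge S-m\}$, and $\pi_{\mathcal{C}}(\boldsymbol{u})=\max\{\boldsymbol{z}^\top\boldsymbol{u}:\boldsymbol{z}\in\mathcal{C}\}$ is its support function. $\delta_{A}$ is the indicator function of a set $A$: $0$ on $A$ and $+\infty$ off $A$. The Fenchel conjugate is $h^*(\boldsymbol{p})=\sup_{\boldsymbol{x}}\{\langle\boldsymbol{p},\boldsymbol{x}\rangle-h(\boldsymbol{x})\}$. An infimum over the empty set is $+\infty$. For a problem $\min\{\phi-\psi\}$ with $\phi,\psi$ closed proper convex, its Toland dual is $\min_{\boldsymbol{p}}\{\psi^*(\boldsymbol{p})-\phi^*(\boldsymbol{p})\}$, with the convention $(+\infty)-(+\infty)=+\infty$ (i.e., the dual is minimized over the domain of $\psi^*$). *)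

(* Defs.v *)
From HB Require Import structures.
From mathcomp Require Import all_boot all_order all_algebra.
From mathcomp Require Import all_classical all_reals all_analysis.

Set Implicit Arguments.
Unset Strict Implicit.
Unset Printing Implicit Defensive.

Import Order.TTheory GRing.Theory Num.Theory.
Import numFieldNormedType.Exports.

Local Open Scope classical_set_scope.
Local Open Scope ring_scope.

Section Euclidean.
Context {R : realType}.

Definition dotp {n : nat} (u v : 'rV[R]_n) : R := \sum_(i < n) u 0 i * v 0 i.

Definition dotp2 {n k : nat} (u v : 'rV[R]_n * 'rV[R]_k) : R :=
  dotp u.1 v.1 + dotp u.2 v.2.

Definition nonneg_orthant {n : nat} : set 'rV[R]_n :=
  [set y | forall i, 0 <= y 0 i].

Definition affine_set {n : nat} (M : set 'rV[R]_n) : Prop :=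
  forall (x y : 'rV[R]_n) (t : R), M x -> M y -> M ((1 - t) *: x + t *: y).

Definition affine_hull {n : nat} (A : set 'rV[R]_n) : set 'rV[R]_n :=
  smallest affine_set A.

Definition relative_interior {n : nat} (A : set 'rV[R]_n) : set 'rV[R]_n :=
  [set x | A x /\ within (affine_hull A) (nbhs x) A].

Definition gradient {n : nat} (f : 'rV[R]_n -> R) (x : 'rV[R]_n) : 'rV[R]_n :=
  \row_(i < n) 'D_(delta_mx 0 i) f x.

(* Meant for U open, so that continuity at x within U is continuity at x. *)
Definition continuously_differentiable_on {n : nat} (U : set 'rV[R]_n)
    (f : 'rV[R]_n -> R) : Prop :=
  forall x, U x -> differentiable f x /\ {for x, continuous (gradient f)}.

(* U is not required to be convex: the inequality is imposed exactly where all
   three values of f are taken in U.  On a convex U this is [convex_function]. *)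
Definition convex_on {n : nat} (U : set 'rV[R]_n) (f : 'rV[R]_n -> R) : Prop :=
  forall (x y : 'rV[R]_n) (t : R), 0 <= t <= 1 ->
    U x -> U y -> U (t *: x + (1 - t) *: y) ->
    f (t *: x + (1 - t) *: y) <= t * f x + (1 - t) * f y.

(* The base point of the iterated max is one of the entries, hence neutral. *)
Definition max_of {N : nat} (hN : (0 < N)%N) (a : 'I_N -> R) : R :=
  \big[Num.max/a (Ordinal hN)]_(i < N) a i.

End Euclidean.

Section ExtendedReal.
Context {R : realType}.
Local Open Scope ereal_scope.

Definition ind {T : Type} (A : set T) (x : T) : \bar R :=
  if x \in A then 0 else +oo.

Definition fenchel_conj {T : Type} (pairing : T -> T -> R)
    (phi : T -> \bar R) (p : T) : \bar R :=
  ereal_sup [set (pairing p x)%:E - phi x | x in [set: T]].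

Definition support {n : nat} (A : set 'rV[R]_n) (u : 'rV[R]_n) : \bar R :=
  ereal_sup [set (dotp z u)%:E | z in A].

(* Objective of the Toland dual of min (phi - psi).  The subtraction is the one
   of [ereal_dual_scope], for which +oo - +oo = +oo. *)
Definition toland_dual {T : Type} (pairing : T -> T -> R)
    (phi psi : T -> \bar R) (p : T) : \bar R :=
  (fenchel_conj pairing psi p - fenchel_conj pairing phi p)%dE.

Definition is_min (A : set (\bar R)) (v : \bar R) : Prop := A v /\ lbound A v.

End ExtendedReal.

Section Problem.
Context {R : realType} {d S : nat}.

Definition scenario_polytope (alpha : R) : set 'rV[R]_S :=
  [set z | (forall s, 0 <= z 0 s <= 1) /\
           S%:R - (Num.floor (alpha * S%:R))%:~R <= \sum_(s < S) z 0 s].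

Definition epi_constraint (g : 'I_S -> 'rV[R]_d -> R) :
    set ('rV[R]_d * 'rV[R]_S) :=
  [set w : 'rV[R]_d * 'rV[R]_S | forall s, g s w.1 <= w.2 0 s].

Definition feasible (X : set 'rV[R]_d) (g : 'I_S -> 'rV[R]_d -> R) :
    set ('rV[R]_d * 'rV[R]_S) :=
  [set w : 'rV[R]_d * 'rV[R]_S |
    [/\ X w.1, nonneg_orthant w.2 & epi_constraint g w]].

Definition zeta_fun (X : set 'rV[R]_d) (f : 'rV[R]_d -> R)
    (g : 'I_S -> 'rV[R]_d -> R) (w : 'rV[R]_d * 'rV[R]_S) : \bar R :=
  ((f w.1)%:E + ind X w.1 + ind nonneg_orthant w.2
     + ind (epi_constraint g) w)%E.

Definition eta_fun (alpha sigma : R) (w : 'rV[R]_d * 'rV[R]_S) : \bar R :=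
  support (scenario_polytope alpha) (- sigma *: w.2).

End Problem.

(* Main.v *)
Require Import Defs.
From HB Require Import structures.
From mathcomp Require Import all_boot all_order all_algebra.
From mathcomp Require Import all_classical all_reals all_analysis.

Set Implicit Arguments.
Unset Strict Implicit.
Unset Printing Implicit Defensive.

Import Order.TTheory GRing.Theory Num.Theory.
Import numFieldNormedType.Exports.

Local Open Scope classical_set_scope.
Local Open Scope ring_scope.

(** The conjugate of a support function is the indicator of its set.  Here
    [eta] is the support function of [C] precomposed with the map
    (x, y) |-> - sigma y, so [eta]^* is finite exactly at the points
    (0, - sigma z) with z in [C], and vanishes there ([conj_support]).
    Outside, the supremum is +oo: along (t p, 0) if p is nonzero, and along
    (0, - (t / sigma) u) if a direction u strictly separates z from [C].  As
    [C] is cut out by finitely many explicit half-spaces, a violated inequality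
    itself provides u ([scenario_polytope_separated]).  The formula for
    [zeta]^* only says that points where [zeta] is +oo contribute -oo to the
    supremum.

    Hence the Toland dual objective is +oo except at the points (0, - sigma z)
    with z in [C], where it equals the inner infimum
      Phi z = inf of f x + sigma <z, y> over feasible (x, y),
    and all three minimization problems are that of Phi over [C].  What is left
    is that this minimum is attained.  Since z >= 0 on [C], the best y for a
    given x is the vector of positive parts of the [g s x], so Phi z is the
    infimum over x in [X] of
      J (x, z) = f x + sigma * sum_s z_s max (g_s x, 0).
    J is jointly continuous and [X] and [C] are compact, so J attains its
    minimum at some (x, z) ([penalized_attains_min]), and this z minimizes
    Phi. *)

(** * Inner product, indicator functions *)

Section DotProduct.
Context {R : realType} {n : nat}.
Implicit Types (u v : 'rV[R]_n) (a : R).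

Lemma dotpZl a u v : dotp (a *: u) v = a * dotp u v.
Proof. by rewrite mulr_sumr; apply: eq_bigr => i _; rewrite mxE mulrA. Qed.

Lemma dotpZr a u v : dotp u (a *: v) = a * dotp u v.
Proof. by rewrite mulr_sumr; apply: eq_bigr => i _; rewrite mxE mulrCA. Qed.

Lemma dotp0l v : dotp 0 v = 0.
Proof. by rewrite -(scale0r v) dotpZl mul0r. Qed.

Lemma dotp0r u : dotp u 0 = 0.
Proof. by rewrite -(scale0r u) dotpZr mul0r. Qed.

Lemma dotp_delta u i : dotp u (delta_mx 0 i) = u 0 i.
Proof.
rewrite /dotp (bigD1 i)//= mxE !eqxx mulr1 big1 ?addr0// => j /negbTE ji.
by rewrite mxE ji andbF mulr0.
Qed.

Lemma dotp_const u a : dotp u (const_mx a) = a * \sum_(i < n) u 0 i.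
Proof. by rewrite mulr_sumr; apply: eq_bigr => i _; rewrite mxE mulrC. Qed.

Lemma dotp_gt0 u : u != 0 -> 0 < dotp u u.
Proof.
move=> /rV0Pn[i ui]; rewrite /dotp (bigD1 i)//= ltr_wpDr//.
  by apply: sumr_ge0 => j _; rewrite -expr2 sqr_ge0.
by rewrite -expr2 exprn_even_gt0.
Qed.

End DotProduct.

Section Indicator.
Context {R : realType} {T : Type}.
Implicit Types (A : set T) (x : T).

Lemma ind_in A x : A x -> ind (R := R) A x = 0%E.
Proof. by move=> Ax; rewrite /ind mem_set. Qed.

Lemma ind_out A x : ~ A x -> ind (R := R) A x = +oo%E.
Proof. by move=> Ax; rewrite /ind memNset. Qed.

Lemma ind_ge0 A x : (0 <= ind (R := R) A x)%E.
Proof. by rewrite /ind; case: ifP => // _; rewrite leey. Qed.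

End Indicator.

(** * Conjugate of a support function *)

Lemma fenchel_young {R : realType} {T : Type} (pairing : T -> T -> R)
    (phi : T -> \bar R) (p x : T) :
  ((pairing p x)%:E - phi x <= fenchel_conj pairing phi p)%E.
Proof. by rewrite /fenchel_conj; apply: ereal_sup_ubound; exists x. Qed.

Section SupportConjugate.
Context {R : realType} {d n : nat}.
Implicit Types (A : set 'rV[R]_n) (p : 'rV[R]_d) (q u z : 'rV[R]_n).
Local Open Scope ereal_scope.

Definition strictly_separated A z :=
  exists u c, (forall a, A a -> (dotp a u <= c)%R) /\ (c < dotp z u)%R.

Lemma support_ge A u z : A z -> (dotp z u)%:E <= Defs.support A u.
Proof. by move=> Az; apply: ereal_sup_ubound; exists z. Qed.

Lemma support_le A u c : (forall z, A z -> (dotp z u <= c)%R) ->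
  Defs.support A u <= c%:E.
Proof. by move=> Ac; apply: ge_ereal_sup => _ [z Az <-]; rewrite lee_fin Ac. Qed.

Variables (A : set 'rV[R]_n) (sigma : R).
Hypothesis sigma_neq0 : sigma != 0%R.
Let eta (w : 'rV[R]_d * 'rV[R]_n) : \bar R := Defs.support A (- sigma *: w.2).

(** Since <- sigma z, y> = <z, - sigma y>, every term of the supremum is at
    most 0 by definition of the support function; the origin gives 0. *)
Lemma conj_support_in z : A z ->
  fenchel_conj dotp2 eta (0%R, (- sigma *: z)%R) = 0.
Proof.
move=> Az; apply/eqP; rewrite eq_le; apply/andP; split.
  apply: ge_ereal_sup => _ [w _ <-]; rewrite sube_le0.
  rewrite /dotp2/= dotp0l add0r dotpZl -dotpZr; exact: support_ge.
apply: (@le_trans _ _ ((dotp2 (0%R, (- sigma *: z)%R) (0%R, 0%R))%:E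
                        - eta (0%R, 0%R))).
  rewrite /dotp2/= dotp0l dotp0r addr0 -[leLHS]sube0 leeB// /eta/= scaler0.
  by apply: support_le => a _; rewrite dotp0r.
exact: fenchel_young.
Qed.

(** [eta] ignores its first argument, so the supremum is unbounded along
    (t p, 0). *)
Lemma conj_support_neq0 p q : p != 0%R -> fenchel_conj dotp2 eta (p, q) = +oo.
Proof.
move=> p0; apply: eq_infty => r.
have pp := dotp_gt0 p0.
(* The factor is the one for which the linear term equals [r]. *)
set w : 'rV[R]_d * 'rV[R]_n := ((r / dotp p p) *: p, 0)%R.
apply: (@le_trans _ _ ((dotp2 (p, q) w)%:E - eta w)); last first.
  exact: fenchel_young.
rewrite /dotp2/= dotpZr dotp0r addr0 divfK ?gt_eqF//.
rewrite -[leLHS]sube0 leeB// /eta/= scaler0.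
by apply: support_le => a _; rewrite dotp0r.
Qed.

(** Along (0, - (t / sigma) u) the linear term grows like t <z, u> and [eta] at
    most like t c, with c < <z, u>. *)
Lemma conj_support_separated p z : strictly_separated A z ->
  fenchel_conj dotp2 eta (p, (- sigma *: z)%R) = +oo.
Proof.
move=> [u [c [Ac cz]]]; apply: eq_infty => r.
have gap : (0 < dotp z u - c)%R by rewrite subr_gt0.
(* With this [t] the gap [t * (dotp z u - c)] is [`|r|], which bounds [r]. *)
set t : R := (`|r| / (dotp z u - c))%R.
have t0 : (0 <= t)%R by rewrite divr_ge0// ltW.
set w : 'rV[R]_d * 'rV[R]_n := (0, (- (t / sigma)) *: u)%R.
apply: (@le_trans _ _ ((dotp2 (p, (- sigma *: z)%R) w)%:E - eta w)); last first.
  exact: fenchel_young.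
have etaw : eta w <= (t * c)%:E.
  rewrite /eta/= scalerA mulrNN mulrCA divff// mulr1.
  by apply: support_le => a /Ac; rewrite dotpZr; exact: ler_wpM2l.
have -> : dotp2 (p, (- sigma *: z)%R) w = (t * dotp z u)%R.
  rewrite /dotp2/= dotp0r add0r dotpZl dotpZr mulrA mulrNN.
  by rewrite mulrCA divff// mulr1.
apply: (@le_trans _ _ ((t * dotp z u)%:E - (t * c)%:E)); last exact: leeB.
by rewrite -EFinB lee_fin -mulrBr divfK ?gt_eqF// ler_norm.
Qed.

(** [z |-> - sigma *: z] is a bijection, so the infimum on the right ranges over
    a single point and the identity is a case split on [p = 0] and [A z].  The
    strict separation of points outside [A] is a hypothesis: it holds for every
    closed convex set, but for a polyhedron it needs no separation theorem. *)
Lemma conj_support : (forall z, ~ A z -> strictly_separated A z) -> forall p q,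
  fenchel_conj dotp2 eta (p, q) =
  ind [set 0%R] p + ereal_inf [set ind A z | z in [set z | (- sigma *: z)%R = q]].
Proof.
move=> sepA p q.
have sN0 : (- sigma != 0)%R by rewrite oppr_eq0.
have [z ->] : exists z, q = (- sigma *: z)%R.
  by exists ((- sigma)^-1 *: q)%R; rewrite scalerA divff// scale1r.
have -> : [set ind A z' | z' in [set z' | (- sigma *: z')%R = (- sigma *: z)%R]]
        = [set ind (R := R) A z].
  by apply/seteqP; split=> [_ [z' /(scalerI sN0) -> <-]|_ ->]//; exists z.
rewrite ereal_inf1; have [->|p0] := eqVneq p 0%R.
  rewrite [ind [set _] _]ind_in// add0e; have [Az|nAz] := pselect (A z).
    by rewrite ind_in// conj_support_in.
  by rewrite ind_out// conj_support_separated//; exact: sepA.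
rewrite conj_support_neq0// [ind [set _] _]ind_out; last exact/eqP.
by rewrite addye// gt_eqF// (lt_le_trans _ (ind_ge0 _ _)).
Qed.

End SupportConjugate.

(** * The scenario polytope *)

Section Polytope.
Context {R : realType} {S : nat}.
Variable alpha : R.
Local Notation C := (@scenario_polytope R S alpha).

(** The normal of a violated inequality is the separating direction: minus the
    all-ones vector for the sum constraint, and minus or plus a basis vector for
    a lower or upper bound. *)
Lemma scenario_polytope_separated z : ~ C z -> strictly_separated C z.
Proof.
move=> nCz; have [z01|] := pselect (forall s, 0 <= z 0 s <= 1).
  have zm : \sum_(s < S) z 0 s < S%:R - (Num.floor (alpha * S%:R))%:~R.
    by rewrite ltNge; apply/negP => zm; exact: nCz.
  exists (const_mx (-1)), (- (S%:R - (Num.floor (alpha * S%:R))%:~R)); split.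
    by move=> a [_ am]; rewrite dotp_const mulN1r lerN2.
  by rewrite dotp_const mulN1r ltrN2.
move=> /existsNP[s /negP]; rewrite negb_and -!ltNge => /orP[zs|zs].
  exists (- 1 *: delta_mx 0 s), 0; split=> [a [/(_ s)/andP[a0 _] _]|];
    by rewrite dotpZr dotp_delta mulN1r ?oppr_le0 ?oppr_gt0.
exists (delta_mx 0 s), 1; split=> [a [/(_ s)/andP[_ a1] _]|];
  by rewrite dotp_delta.
Qed.

Lemma sum_coord_continuous : continuous (fun z : 'rV[R]_S => \sum_(s < S) z 0 s).
Proof.
by apply: continuous_big => [|s _]; [exact: add_continuous|exact: coord_continuous].
Qed.

(** A closed half-space intersected with the cube [0, 1]^S. *)
Lemma scenario_polytope_compact : compact C.
Proof.
have cube : compact [set z : 'rV[R]_S | forall s, `[0, 1]%classic (z ord0 s)].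
  by apply: (@rV_compact R S (fun=> `[0, 1]%classic)) => s; exact: segment_compact.
have half : closed [set z : 'rV[R]_S |
    S%:R - (Num.floor (alpha * S%:R))%:~R <= \sum_(s < S) z 0 s].
  have sumC : {in ~` ((fun z : 'rV[R]_S => \sum_(s < S) z 0 s) @^-1`
      [set t | S%:R - (Num.floor (alpha * S%:R))%:~R <= t]),
      continuous (fun z : 'rV[R]_S => \sum_(s < S) z 0 s)}.
    by move=> z _; exact: sum_coord_continuous.
  exact: (preimage_closed sumC (@closed_ge _ _)).
suff -> : C = [set z : 'rV[R]_S | forall s, `[0, 1]%classic (z ord0 s)]
    `&` [set z | S%:R - (Num.floor (alpha * S%:R))%:~R <= \sum_(s < S) z 0 s].
  exact: (compact_closedI cube half).
by apply/seteqP; split=> z [z01 zm]; split=> // s; have := z01 s;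
  rewrite /= in_itv.
Qed.

(** The all-ones vector works because floor (alpha S) >= 0. *)
Lemma scenario_polytope_neq0 : 0 <= alpha -> C !=set0.
Proof.
move=> alpha0; exists (const_mx 1); split=> [s|].
  by rewrite mxE ler01 lexx.
rewrite (eq_bigr (fun=> 1)); last by move=> s _; rewrite mxE.
rewrite sumr_const card_ord lerBlDr lerDl ler0z floor_ge0.
by rewrite mulr_ge0// ler0n.
Qed.

End Polytope.

(** * Continuity of finite maxima *)

(** The base point of the iterated maximum varies with [x], hence an induction
    in place of the continuity of iterated operators with a fixed one. *)
Lemma max_of_continuous {R : realType} {T : topologicalType} {N : nat}
    (hN : (0 < N)%N) (a : 'I_N -> T -> R) :
  (forall i, continuous (a i)) -> continuous (fun x => max_of hN (a ^~ x)).
Proof.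
move=> ca; rewrite /max_of; elim: (index_enum _) => [|i r IHr] x.
  under eq_fun do rewrite big_nil.
  exact: ca.
under eq_fun do rewrite big_cons.
exact: (continuous_max (ca i x) (IHr x)).
Qed.

(** * The penalized problem *)

Section Problem.
Context {R : realType} {d S : nat}.
Variables (X : set 'rV[R]_d) (f : 'rV[R]_d -> R) (g : 'I_S -> 'rV[R]_d -> R).
Implicit Types (x p : 'rV[R]_d) (y q z : 'rV[R]_S) (w : 'rV[R]_d * 'rV[R]_S).
Local Notation F := (feasible X g).

Lemma zeta_fun_in w : F w -> zeta_fun X f g w = (f w.1)%:E.
Proof. by move=> [Xw yw gw]; rewrite /zeta_fun !ind_in// !adde0. Qed.

Lemma zeta_fun_out w : ~ F w -> zeta_fun X f g w = +oo%E.
Proof.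
rewrite /zeta_fun => nF.
have [Xw|nXw] := pselect (X w.1); last first.
  rewrite (ind_out nXw) addey// addye ?addye//;
  by rewrite gt_eqF// (lt_le_trans _ (ind_ge0 _ _)).
have [yw|nyw] := pselect (nonneg_orthant w.2); last first.
  rewrite (ind_in Xw) adde0 (ind_out nyw) addey// addye//.
  by rewrite gt_eqF// (lt_le_trans _ (ind_ge0 _ _)).
rewrite [X in (_ + X)%E]ind_out ?addey//; last by move=> gw; apply: nF.
by rewrite !ind_in.
Qed.

Lemma conj_zeta p q :
  fenchel_conj dotp2 (zeta_fun X f g) (p, q) =
  ereal_sup [set (dotp p w.1 + dotp q w.2 - f w.1)%:E | w in F].
Proof.
apply/eqP; rewrite eq_le; apply/andP; split; apply: ge_ereal_sup => _ [w Fw <-].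
  have [{}Fw|nFw] := pselect (F w); last by rewrite zeta_fun_out// leNye.
  by apply: ereal_sup_ubound; exists w => //; rewrite zeta_fun_in.
by apply: ereal_sup_ubound; exists w => //; rewrite zeta_fun_in.
Qed.

(** At (0, - sigma z) the terms of the supremum defining the conjugate are the
    opposites of f x + sigma <z, y>, and - sup = inf -. *)
Lemma oppe_conj_zeta sigma z :
  (- fenchel_conj dotp2 (zeta_fun X f g) (0%R, (- sigma *: z)%R))%E =
  ereal_inf [set (f w.1 + sigma * dotp z w.2)%:E | w in F].
Proof.
rewrite conj_zeta ereal_infEN image_comp; congr (- ereal_sup _)%E.
apply: eq_imagel => w _ /=; congr (_%:E).
by rewrite dotp0l dotpZl mulNr add0r opprD addrC.
Qed.

(** The least [y] for which [(x, y)] is feasible, when [x] is in [X]. *)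
Definition violation x : 'rV[R]_S := \row_s Num.max (g s x) 0.

Lemma violation_feasible x : X x -> F (x, violation x).
Proof. by move=> Xx; split=> // s; rewrite /= mxE le_max lexx ?orbT. Qed.

Lemma violation_le w : F w -> forall s, violation w.1 0 s <= w.2 0 s.
Proof. by move=> [_ yw gw] s; rewrite mxE ge_max yw gw. Qed.

(** The inner objective with [y] minimized out, as a function of [x] and [z]. *)
Definition penalized sigma (xz : 'rV[R]_d * 'rV[R]_S) : R :=
  f xz.1 + sigma * dotp xz.2 (violation xz.1).

(** Minimizing over both variables at once avoids proving that the inner infimum
    is a semicontinuous function of [z]. *)
Lemma penalized_attains_min sigma (C : set 'rV[R]_S) :
  X !=set0 -> compact X -> (forall x, X x -> {for x, continuous f}) ->
  (forall s, continuous (g s)) -> C !=set0 -> compact C ->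
  exists x z, [/\ X x, C z & forall x' z', X x' -> C z' ->
    penalized sigma (x, z) <= penalized sigma (x', z')].
Proof.
move=> [x0 Xx0] cX cf cg [z0 Cz0] cC.
have XC0 : X `*` C !=set0 by exists (x0, z0).
have cXC := compact_setX cX cC.
have cJ : {within X `*` C, continuous (penalized sigma)}.
  apply: continuous_in_subspaceT => xz /set_mem[/= Xx _].
  apply: cvgD.
    apply: (@cvg_comp _ _ _ fst f _ (nbhs xz.1)); [exact: cvg_fst|exact: cf].
  apply: cvgM; first exact: cvg_cst.
  rewrite /dotp; apply: cvg_big => [|s _]; first exact: add_continuous.
  apply: cvgM.
    apply: (@cvg_comp _ _ _ snd (fun z : 'rV[R]_S => z 0 s) _ (nbhs xz.2));
      [exact: cvg_snd|exact: coord_continuous].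
  under eq_fun do rewrite mxE.
  rewrite mxE; apply: (@continuous_max _ _ (fun xz => g s xz.1) (cst 0)).
    apply: (@cvg_comp _ _ _ fst (g s) _ (nbhs xz.1)); [exact: cvg_fst|exact: cg].
  exact: cvg_cst.
have [[x z] /set_mem[Xx Cz] min] := compact_EVT_min XC0 cXC cJ.
by exists x, z; split=> // x' z' Xx' Cz'; apply: min; exact/mem_set.
Qed.

(** For [z >= 0] the objective is monotone in [y], and feasible [y] lie above
    [violation x]. *)
Lemma inner_inf_ge sigma z v : 0 <= sigma -> (forall s, 0 <= z 0 s) ->
  (forall x, X x -> v <= penalized sigma (x, z)) ->
  (v%:E <= ereal_inf [set (f w.1 + sigma * dotp z w.2)%:E | w in F])%E.
Proof.
move=> s0 z0 vX; apply: le_ereal_inf_tmp => _ [w Fw <-]; rewrite lee_fin.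
case: (Fw) => Xw _ _; apply: le_trans (vX _ Xw) _.
rewrite /penalized lerD2l ler_wpM2l// ler_sum// => s _.
by apply: ler_wpM2l => //; exact: (violation_le Fw).
Qed.

Lemma inner_inf_le sigma x z : X x ->
  (ereal_inf [set (f w.1 + sigma * dotp z w.2)%:E | w in F]
    <= (penalized sigma (x, z))%:E)%E.
Proof.
by move=> Xx; apply: ereal_inf_lbound; exists (x, violation x) => //;
  exact: violation_feasible.
Qed.

End Problem.

Theorem proposition2p3 (R : realType) (d S N : nat)
    (hS : (0 < S)%N) (hN : (0 < N)%N)
    (alpha : R) (halpha : 0 < alpha < 1)
    (X U : set 'rV[R]_d)
    (X_compact : compact X) (X_convex : convex_set X)
    (X_relint : relative_interior X !=set0)
    (U_open : open U) (X_sub_U : X `<=` U)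
    (f : 'rV[R]_d -> R)
    (f_C1 : continuously_differentiable_on U f) (f_convex : convex_on U f)
    (h : 'I_S -> 'I_N -> 'rV[R]_d -> R)
    (h_C1 : forall s i, continuously_differentiable_on setT (h s i))
    (h_convex : forall s i, convex_function setT (h s i))
    (sigma : R) (hsigma : 0 < sigma) :
  let g : 'I_S -> 'rV[R]_d -> R := fun s x => max_of hN (fun i => h s i x) in
  let C : set 'rV[R]_S := scenario_polytope alpha in
  let F : set ('rV[R]_d * 'rV[R]_S) := feasible X g in
  let zeta : 'rV[R]_d * 'rV[R]_S -> \bar R := zeta_fun X f g in
  let eta : 'rV[R]_d * 'rV[R]_S -> \bar R := eta_fun alpha sigma in
  [/\ forall (p : 'rV[R]_d) (q : 'rV[R]_S),
        fenchel_conj dotp2 eta (p, q) =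
        (ind [set 0%R] p +
           ereal_inf [set ind C z | z in [set z | (- sigma *: z)%R = q]])%E,
      forall (p : 'rV[R]_d) (q : 'rV[R]_S),
        fenchel_conj dotp2 zeta (p, q) =
        ereal_sup [set (dotp p w.1 + dotp q w.2 - f w.1)%:E | w in F]
    & exists v : \bar R,
        [/\ is_min (range (toland_dual dotp2 zeta eta)) v,
            is_min [set (- fenchel_conj dotp2 zeta (0%R, (- sigma *: z)%R))%E
                   | z in C] v
          & is_min [set ereal_inf [set (f w.1 + sigma * dotp z w.2)%:E | w in F]
                   | z in C] v]].
Proof.
move=> g C F zeta eta.
have sigma_neq0 : sigma != 0 by rewrite gt_eqF.
have conj_etaE := conj_support (d := d) sigma_neq0
  (@scenario_polytope_separated R S alpha).
split; [exact: conj_etaE|exact: conj_zeta|].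
pose inner z := ereal_inf [set (f w.1 + sigma * dotp z w.2)%:E | w in F].
have X_neq0 : X !=set0 by case: X_relint => x [Xx _]; exists x.
have f_cont x : X x -> {for x, continuous f}.
  by move=> /X_sub_U/f_C1[df _]; exact: differentiable_continuous.
have g_cont s : continuous (g s).
  apply: max_of_continuous => i x; have [dh _] := h_C1 s i x I.
  exact: differentiable_continuous.
have C_neq0 : C !=set0.
  by apply: scenario_polytope_neq0; case/andP: halpha => /ltW.
have [x [z [Xx Cz min]]] := penalized_attains_min sigma
  X_neq0 X_compact f_cont g_cont C_neq0 (@scenario_polytope_compact R S alpha).
set v : \bar R := (penalized f g sigma (x, z))%:E.
have v_le z' : C z' -> (v <= inner z')%E.
  move=> Cz'; apply: inner_inf_ge => [|s|x' Xx']; [exact: ltW| |exact: min].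
  by case: Cz' => /(_ s)/andP[].
have vE : inner z = v.
  by apply/eqP; rewrite eq_le v_le// andbT; exact: inner_inf_le.
have inner_min : is_min [set inner z | z in C] v.
  by split=> [|_ [z' Cz' <-]]; [exists z|exact: v_le].
have toland_in z' : C z' ->
    toland_dual dotp2 zeta eta (0, - sigma *: z') = inner z'.
  move=> Cz'; rewrite /toland_dual conj_support_in//.
  by rewrite DualAddTheoryNumDomain.dadd0e; exact: oppe_conj_zeta.
exists v; split=> //; last first.
  suff -> : [set (- fenchel_conj dotp2 zeta (0%R, (- sigma *: z)%R))%E | z in C]
    = [set inner z | z in C] by [].
  by apply: eq_imagel => z' _; exact: oppe_conj_zeta.
split; first by exists (0, - sigma *: z) => //; rewrite toland_in.
(* Off the points (0, - sigma z) with z in C the dual objective is +oo. *)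
move=> _ [[p q] _ <-].
have [z' ->] : exists z', q = - sigma *: z'.
  by exists ((- sigma)^-1 *: q); rewrite scalerA divff ?oppr_eq0// scale1r.
have [->|p0] := eqVneq p 0; last first.
  rewrite /toland_dual conj_support_neq0//.
  by rewrite DualAddTheoryNumDomain.daddye leey.
have [Cz'|nCz'] := pselect (C z'); first by rewrite toland_in// v_le.
rewrite /toland_dual conj_support_separated//.
  by rewrite DualAddTheoryNumDomain.daddye leey.
exact: scenario_polytope_separated.
Qed.
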